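(* Suppose that $\beta$ and $\gamma$ are two compositions of $n$ such that $\beta\preccurlyeq\gamma$. Let $(n_1,\ldots,n_k)$ be the composition of $n$ whose descent set equals $D(\gamma)\setminus D(\beta)$, and write $\beta=\alpha^1\rhd\cdots\rhd\alpha^k$ and $\gamma=\alpha^1\cdots\alpha^k$, where $\alpha^i\models n_i$. Then $$\sum_{\beta\preccurlyeq\alpha\preccurlyeq\gamma}r_\alpha(q)=\begin{bmatrix} n \\ {n_1,\ldots,n_k} \end{bmatrix}_q\,r_{\alpha^1}(q)\cdots r_{\alpha^k}(q).$$
   Context: A composition $\alpha=(\alpha_1,\ldots,\alpha_\ell)$ of $n$ ($\alpha\models n$) is a sequence of positive integers with sum $n$; its descent set is $D(\alpha)=\{\alpha_1,\alpha_1+\alpha_2,\ldots,\alpha_1+\cdots+\alpha_{\ell-1}\}\subseteq\{1,\ldots,n-1\}$. For compositions of the same size, $\alpha\preccurlyeq\beta$ means $D(\alpha)\subseteq D(\beta)$. For compositions $\alpha=(\alpha_1,\ldots,\alpha_\ell)$ and $\beta=(\beta_1,\ldots,\beta_m)$, $\alpha\cdot\beta=(\alpha_1,\ldots,\alpha_\ell,\beta_1,\ldots,\beta_m)$ and $\alpha\rhd\beta=(\alpha_1,\ldots,\alpha_{\ell-1},\alpha_\ell+\beta_1,\beta_2,\ldots,\beta_m)$; $\alpha^1\cdots\alpha^k$ denotes the concatenation of compositions $\alpha^1,\ldots,\alpha^k$. For $w\in\mathfrak S_n$, $D(w)=\{i\in\{1,\ldots,n-1\}:w(i)>w(i+1)\}$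 and $\mathrm{inv}(w)=\#\{(i,j):1\le i<j\le n,\ w(i)>w(j)\}$. For $\alpha\models n$, the $q$-ribbon number is $r_\alpha(q):=\sum_{w\in\mathfrak S_n:\,D(w)=D(\alpha)}q^{\mathrm{inv}(w)}$. The $q$-multinomial coefficient is $$\begin{bmatrix} n \\ {n_1,\ldots,n_k} \end{bmatrix}_q:=\frac{[n]!_q}{[n_1]!_q\cdots[n_k]!_q},\qquad[m]_q=1+q+\cdots+q^{m-1},\quad[m]!_q=[m]_q[m-1]_q\cdots[1]_q .$$ *)

(* Defs.v *)
From HB Require Import structures.
From mathcomp Require Import all_boot all_order all_fingroup all_algebra.

Set Implicit Arguments.
Unset Strict Implicit.
Unset Printing Implicit Defensive.

Import GRing.Theory.

Record composition (n : nat) := Composition {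
  parts :> seq nat;
  _ : (0 \notin parts) && (sumn parts == n)
}.

HB.instance Definition _ n := [isSub for @parts n].
HB.instance Definition _ n := [Countable of composition n by <:].

(* A composition of n has at most n parts, each at most n, so compositions
   embed in n.-bseq 'I_n.+1; this is only used to get the finType structure. *)
Section CompositionFinite.
Variable n : nat.

Definition comp_code (c : composition n) : n.-bseq 'I_n.+1 :=
  insub_bseq n [seq inord m | m <- parts c].

Definition comp_decode (s : n.-bseq 'I_n.+1) : option (composition n) :=
  insub [seq nat_of_ord i | i <- s].

Lemma size_le_sumn (s : seq nat) : 0 \notin s -> size s <= sumn s.
Proof.
elim: s => //= x s IHs; rewrite inE negb_or => /andP[x_neq0 /IHs le_s].
by rewrite -add1n leq_add // lt0n eq_sym.
Qed.

Lemma mem_le_sumn (s : seq nat) m : m \in s -> m <= sumn s.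
Proof.
elim: s => //= x s IHs; rewrite inE => /predU1P[-> | /IHs le_m].
  exact: leq_addr.
exact: leq_trans le_m (leq_addl _ _).
Qed.

Lemma comp_codeK : pcancel comp_code comp_decode.
Proof.
case=> s c_s; have /andP[s_gt0 /eqP sum_s] := c_s.
have sz : size [seq (inord m : 'I_n.+1) | m <- s] <= n.
  by rewrite size_map -sum_s size_le_sumn.
rewrite /comp_decode /comp_code /insub_bseq val_insubd sz -map_comp.
rewrite (@eq_in_map _ _ _ id s).1 ?map_id; first by rewrite insubT.
by move=> m m_s /=; rewrite inordK // ltnS -sum_s mem_le_sumn.
Qed.

HB.instance Definition _ := isFinite.Build (composition n)
  (@pcan_enumP (composition n) (n.-bseq 'I_n.+1) _ _ comp_codeK).

End CompositionFinite.

(* Descent sets are subsets of {1, ..., n-1}, represented in {set 'I_n}; the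
   value i : 'I_n is the descent position itself, so 0 is never a member. *)
Definition descents n (c : composition n) : {set 'I_n} :=
  [set i : 'I_n | [exists j : 'I_(size c), (0 < j) && (i == sumn (take j c) :> nat)]].

(* Position k + 1 of a permutation of {1, ..., n} is the index k : 'I_n, so
   that i is a descent iff w (i - 1) > w i in 0-based indices. *)
Definition perm_descents n (w : 'S_n) : {set 'I_n} :=
  [set i : 'I_n | [exists k : 'I_n, (k.+1 == i) && (w i < w k)]].

Definition inv n (w : 'S_n) : nat :=
  #|[set p : 'I_n * 'I_n | (p.1 < p.2) && (w p.2 < w p.1)]|.

Definition refines n (c d : composition n) : bool := descents c \subset descents d.

(* On nonempty sequences this is the near-concatenation
   (s_1, ..., s_{l-1}, s_l + t_1, t_2, ..., t_m); [::] is made a unit, so that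
   k-fold products can be folded from [::]. *)
Definition rhd (s t : seq nat) : seq nat :=
  if s is x :: s' then belast x s' ++ (last x s' + head 0 t) :: behead t else t.

Definition rhd_prod (ss : seq (seq nat)) : seq nat := foldr rhd [::] ss.

(* Families (a_i) with a_i a composition of the i-th part of nu. *)
Definition comp_family n (nu : composition n) :=
  forall i : 'I_(size nu), composition (nth 0 nu i).

Definition family_seq n (nu : composition n) (a : comp_family nu) : seq (seq nat) :=
  [seq parts (a i) | i <- enum 'I_(size nu)].

Definition is_decomposition n (b g nu : composition n) (a : comp_family nu) : Prop :=
  [/\ descents nu = descents g :\: descents b,
      parts b = rhd_prod (family_seq a)
    & parts g = flatten (family_seq a)].

Local Open Scope ring_scope.

Definition q_ribbon n (c : composition n) : {poly int} :=
  \sum_(w : 'S_n | perm_descents w == descents c) 'X^(inv w).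

Definition q_int (m : nat) : {poly int} := \sum_(i < m) 'X^i.

Definition q_fact (m : nat) : {poly int} := \prod_(1 <= i < m.+1) q_int i.

Notation "x %:F" := (tofrac x) : ring_scope.

(* The quotient is taken in the fraction field of Z[q]. *)
Definition q_multinomial (n : nat) (s : seq nat) : {fraction {poly int}} :=
  (q_fact n)%:F / \prod_(m <- s) (q_fact m)%:F.

(* Main.v *)
Require Import Defs.
From mathcomp Require Import all_boot all_order all_fingroup all_algebra.
From mathcomp Require Import zify.

(* Summing r_alpha over the interval [beta, gamma] collects the permutations w with
   D(beta) <= D(w) <= D(gamma).  Such w are unconstrained at the positions of
   D(gamma) \ D(beta), which cut w into k blocks, while inside the i-th block the
   descents of w are those of alpha^i.  For two blocks of sizes m and p, w is
   averaged over the permutations of each block: this leaves the inversions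
   between blocks unchanged and gives
     m! p! S(constraints) = A r(first block) r(second block),
   where A does not depend on the constraints inside the blocks.  The case without
   any constraints, S = [m+p]!_q, evaluates A, so the q-binomial coefficient is
   never counted directly.  The general case follows by induction on k. *)

Set Implicit Arguments.
Unset Strict Implicit.
Unset Printing Implicit Defensive.

Import GRing.Theory.

(** * Partial sums of sequences and descent sets of compositions *)

Fixpoint partial_sums (s : seq nat) : seq nat :=
  if s is x :: s' then x :: [seq x + y | y <- partial_sums s'] else [::].

Lemma mem_map_addn m (s : seq nat) i :
  (i \in [seq m + y | y <- s]) = (m <= i) && (i - m \in s).
Proof.
apply/mapP/andP => [[y ys ->]|[mi ims]]; first by rewrite leq_addr addKn.
by exists (i - m); rewrite ?subnKC.
Qed.

Lemma mem_partial_sums_cons x s i :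
  (i \in partial_sums (x :: s)) =
    (i == x) || (x <= i) && (i - x \in partial_sums s).
Proof. by rewrite inE mem_map_addn. Qed.

Lemma partial_sumsP s i :
  reflect (exists2 j, 0 < j <= size s & i = sumn (take j s))
          (i \in partial_sums s).
Proof.
elim: s i => [|x s IHs] i; first by right; case=> -[|j].
rewrite mem_partial_sums_cons; apply: (iffP orP) =>
  [[/eqP->|/andP[xi /IHs[j jP ij]]]|[[|j] // jP ->]].
- by exists 1; rewrite //= take0 addn0.
- by exists j.+1; [case/andP: jP | rewrite /= -ij subnKC].
case: j jP => [|j] jP; first by left; rewrite /= take0 addn0.
by right; rewrite leq_addr addKn; apply/IHs; exists j.+1.
Qed.

Lemma partial_sums_gt0 s : 0 \notin s -> 0 \notin partial_sums s.
Proof.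
case: s => // x s; rewrite mem_partial_sums_cons inE !negb_or => /andP[x0 _].
by rewrite x0 leqn0 eq_sym (negbTE x0).
Qed.

Lemma partial_sums_le s i : i \in partial_sums s -> i <= sumn s.
Proof.
by case/partial_sumsP => j _ ->; rewrite -{2}(cat_take_drop j s) sumn_cat leq_addr.
Qed.

Lemma sumn_partial_sums s : s != [::] -> sumn s \in partial_sums s.
Proof.
case: s => // x s _; apply/partial_sumsP.
by exists (size s).+1; rewrite /= ?take_size ?leqnn.
Qed.

Lemma partial_sums_cat s t :
  partial_sums (s ++ t) =
    partial_sums s ++ [seq sumn s + y | y <- partial_sums t].
Proof.
elim: s => [|x s IHs] /=; first by rewrite map_id.
rewrite IHs map_cat -map_comp; congr (_ :: _ ++ _).
by apply: eq_map => y /=; rewrite addnA.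
Qed.

(** [partial_sums] also contains the total n, which keeps its recursion uniform; restricting to
    indices in ['I_n] removes exactly this value. *)
Lemma mem_descents n (c : composition n) (i : 'I_n) :
  (i \in descents c) = ((i : nat) \in partial_sums c).
Proof.
have /andP[_ /eqP sum_c] := valP c.
rewrite inE; apply/existsP/partial_sumsP => [[j /andP[j0 /eqP ->]]|[j /andP[j0 jc] ij]].
  by exists j; rewrite // j0 ltnW.
case: (ltnP j (size c)) => jlt; first by exists (Ordinal jlt); rewrite j0 ij eqxx.
by have := ltn_ord i; rewrite ij take_oversize // sum_c ltnn.
Qed.

(** With positive parts the head is the least partial sum, so the heads agree; subtracting the
    common head reduces to the tails. *)
Lemma partial_sums_inj s t :
  0 \notin s -> 0 \notin t -> partial_sums s =i partial_sums t -> s = t.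
Proof.
elim: s t => [|x s IHs] [|y t] //.
- by move=> _ _ /(_ y); rewrite mem_head.
- by move=> _ _ /(_ x); rewrite mem_head.
rewrite !inE !negb_or => /andP[x0 s0] /andP[y0 t0] st.
have xy : x = y.
  have : x \in partial_sums (y :: t) by rewrite -st mem_partial_sums_cons eqxx.
  have : y \in partial_sums (x :: s) by rewrite st mem_partial_sums_cons eqxx.
  rewrite !mem_partial_sums_cons.
  by do 2![case/orP => [/eqP ?|/andP[? _]]]; lia.
rewrite -{}xy in st *; congr (_ :: _); apply: IHs => // i.
case: i => [|i]; first by rewrite !(negbTE (partial_sums_gt0 _)).
have := st (x + i.+1); rewrite !mem_partial_sums_cons leq_addr addKn.
by have /negbTE-> : x + i.+1 != x by lia.
Qed.

Lemma descents_inj n : injective (@descents n).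
Proof.
move=> c d /setP cd; apply: val_inj.
have /andP[c0 /eqP sc] := valP c; have /andP[d0 /eqP sd] := valP d.
apply: partial_sums_inj => // i /=.
(* Descent sets only see i < n. Nothing above n is a partial sum, and n itself is one for both
   compositions unless n = 0. *)
case: (ltngtP i n) => ni.
- by have := cd (Ordinal ni); rewrite !mem_descents.
- by apply/idP/idP => /partial_sums_le; rewrite ?sc ?sd leqNgt ni.
case: (posnP i) => [->|i0]; first by rewrite !(negbTE (partial_sums_gt0 _)).
have mem_i s : sumn s = n -> i \in partial_sums s.
  move=> sn; rewrite ni -sn sumn_partial_sums //.
  by apply: contraTneq i0 => s0; rewrite ni -sn s0.
by rewrite !mem_i.
Qed.

(** Induction on n with [P] shifted by one: if [P 1] holds, a part 1 is put in front, otherwise the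
    first part grows by 1. *)
Lemma partial_sums_surj n (P : pred nat) :
  exists s, [/\ 0 \notin s, sumn s = n
    & forall i, 0 < i < n -> (i \in partial_sums s) = P i].
Proof.
elim: n P => [|[|n] IHn] P; first by exists [::]; split=> // -[].
  by exists [:: 1]; split=> // -[|[]].
have [ys [+ + +]] := IHn (P \o S); case: ys => [|y s] // s0 sums sP.
have /negbTE ps0 := partial_sums_gt0 s0.
case P1: (P 1).
  exists [:: 1, y & s]; split; [by rewrite inE | by rewrite -sums |].
  by move=> [|[|i]] // /andP[_ ilt]; rewrite mem_partial_sums_cons subn1 sP.
exists (y.+1 :: s); split; [by move: s0; rewrite !inE negb_or => /andP[] | by rewrite -sums |].
move=> [|i] // /andP[_ ilt]; rewrite mem_partial_sums_cons subSS eqSS ltnS.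
rewrite -mem_partial_sums_cons; case: i ilt => [|i] ilt; first by rewrite ps0 P1.
by rewrite sP.
Qed.

Lemma descents_surj n (A : {set 'I_n}) :
  (forall i, i \in A -> 0 < i) -> exists c : composition n, descents c = A.
Proof.
move=> A0; have [s [s0 sums sP]] := partial_sums_surj n (fun i => [exists j in A, j == i :> nat]).
have c_s : (0 \notin s) && (sumn s == n) by rewrite s0 sums eqxx.
exists (Composition c_s); apply/setP => i; rewrite mem_descents /=.
case: (posnP i) => [i0|i0].
  rewrite i0 (negbTE (partial_sums_gt0 s0)); apply/esym/negP => /A0.
  by rewrite i0.
rewrite sP ?i0 ?ltn_ord //; apply/existsP/idP => [[j /andP[jA /eqP/val_inj <-]] //|iA].
by exists i; rewrite iA eqxx.
Qed.

(** * Near-concatenation and decomposition into blocks *)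

Definition good_blocks (ss : seq (seq nat)) : bool :=
  all (fun s => (s != [::]) && (0 \notin s)) ss.

Lemma rhds0 s : rhd s [::] = s.
Proof. by case: s => //= x s; rewrite addn0 cats1 -lastI. Qed.

Lemma rhd_cons x s t : s != [::] -> rhd (x :: s) t = x :: rhd s t.
Proof. by case: s. Qed.

Lemma sumn_gt0 s : s != [::] -> 0 \notin s -> 0 < sumn s.
Proof. by case: s => // x s _; rewrite inE negb_or => /andP[]; case: x. Qed.

(** Merging the two parts that meet erases the junction: at i = [sumn s] the second branch asks for
    0, which is never a partial sum of [t]. *)
Lemma mem_partial_sums_rhd s t i :
  s != [::] -> 0 \notin s -> t != [::] -> 0 \notin t ->
  (i \in partial_sums (rhd s t)) =
    if i < sumn s then i \in partial_sums s else i - sumn s \in partial_sums t.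
Proof.
move=> + + t_n0 t0; case: s => // x s _.
elim: s x i => [|z s IHs] x i; rewrite in_cons negb_or => /andP[x0 s0].
  case: t t_n0 t0 => // y t _; rewrite in_cons negb_or => /andP[y0 t0].
  have -> : rhd [:: x] (y :: t) = x + y :: t by [].
  rewrite !mem_partial_sums_cons [sumn _]addn0 in_nil; case: ltnP => ix; first by lia.
  have -> : (i == x + y) = (i - x == y) by lia.
  by rewrite subnDA; have -> : (x + y <= i) = (y <= i - x) by lia.
rewrite rhd_cons // [LHS]mem_partial_sums_cons IHs //.
rewrite [i \in partial_sums [:: x, z & s]]mem_partial_sums_cons.
have := sumn_gt0 (isT : z :: s != [::]) s0; set S := sumn (z :: s) => S0.
have -> : sumn [:: x, z & s] = x + S by [].
case: (eqVneq i x) => [->|i_x] /=; first by rewrite ifT //; lia.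
case: (leqP x i) => xi /=; last by rewrite ifT //; lia.
by rewrite subnDA; have -> : (i < x + S) = (i - x < S) by lia.
Qed.

Lemma rhd_prod_cons s ss : rhd_prod (s :: ss) = rhd s (rhd_prod ss).
Proof. by []. Qed.

Lemma rhd_neq_nil s t : s != [::] -> rhd s t != [::].
Proof. by case: s => // x s _; rewrite -size_eq0 /= size_cat addnS. Qed.

Lemma rhd_gt0 s t : 0 \notin s -> 0 \notin t -> 0 \notin rhd s t.
Proof.
move=> + t0; case: s => // x s; elim: s x => [|z s IHs] x; last first.
  by rewrite in_cons negb_or rhd_cons // => /andP[x0 /IHs zs]; rewrite in_cons negb_or x0.
case: t t0 => [|y t]; first by rewrite rhds0.
rewrite in_cons negb_or => /andP[y0 t0]; rewrite mem_seq1 => x0.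
have -> : rhd [:: x] (y :: t) = x + y :: t by [].
by rewrite in_cons negb_or t0 andbT; lia.
Qed.

Lemma good_rhd_prod ss : good_blocks ss -> ss != [::] ->
  (rhd_prod ss != [::]) && (0 \notin rhd_prod ss).
Proof.
elim: ss => // s ss IHs /andP[/andP[s_n0 s0] ss_ok] _.
rewrite rhd_prod_cons rhd_neq_nil //=; apply: rhd_gt0 => //.
by case: ss IHs ss_ok => // s' ss IHs ss_ok; have /andP[] := IHs ss_ok isT.
Qed.

(** Concatenation and near-concatenation agree inside the blocks and differ exactly at the
    junctions. This yields the description of the block sizes by D(gamma) \ D(beta). The upper bound
    on i excludes the total, which both contain. *)
Lemma mem_partial_sums_sumn_blocks ss i : good_blocks ss ->
  0 < i < sumn (flatten ss) ->
  (i \in partial_sums (map sumn ss)) =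
    (i \in partial_sums (flatten ss)) && (i \notin partial_sums (rhd_prod ss)).
Proof.
elim: ss i => // s ss IHs i /andP[/andP[s_n0 s0] ss_ok] /=.
rewrite mem_partial_sums_cons partial_sums_cat mem_cat mem_map_addn.
case: (eqVneq ss [::]) => [->|ss_n0] /=.
  by rewrite rhds0 in_nil !andbF !orbF cats0 andbN => /andP[_]; case: ltngtP.
have /andP[p_n0 p0] := good_rhd_prod ss_ok ss_n0.
rewrite mem_partial_sums_rhd // sumn_cat => /andP[i0 ilt].
have ps_gt0 := partial_sums_gt0 p0.
case: (ltngtP i (sumn s)) => si /=.
- by rewrite orbF andbN.
- rewrite IHs //; last by rewrite subn_gt0 si ltn_subLR // ltnW.
  suff /negbTE-> : i \notin partial_sums s by [].
  by apply: contraL si => /partial_sums_le; rewrite -leqNgt.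
by rewrite si subnn sumn_partial_sums.
Qed.

(** Induction on [g], comparing the first parts x of [g] and z of [b], where x <= z. If x = z, then
    x is not a junction and joins the next block. If x < z, then x is a junction: it forms a block
    of its own, and [b] continues with z - x. *)
Lemma exists_blocks b g : 0 \notin b -> 0 \notin g -> sumn b = sumn g ->
  {subset partial_sums b <= partial_sums g} ->
  exists ss, [/\ good_blocks ss, b = rhd_prod ss & g = flatten ss].
Proof.
elim: g b => [|x g IHg] b b0 g0 bg sub_bg.
  exists [::]; case: b b0 bg {sub_bg} => // y b.
  by rewrite inE negb_or => /andP[y0 _] /eqP; rewrite addn_eq0 eq_sym (negbTE y0).
have [x0 {}g0] : x != 0 /\ 0 \notin g.
  by move: g0; rewrite inE negb_or eq_sym => /andP.
case: b b0 bg sub_bg => [|z b]; first by move=> _ /esym/eqP; rewrite addn_eq0 (negbTE x0).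
rewrite inE negb_or eq_sym => /andP[z0 b0] /= bg sub_bg.
have xz : x <= z.
  have := sub_bg z; rewrite mem_partial_sums_cons eqxx => /(_ isT).
  by rewrite mem_partial_sums_cons => /orP[/eqP->|/andP[]].
(* The inclusion survives removing x from the front; y = 0 must be excluded because z - x may
   vanish. *)
have sub' y : y \in partial_sums (z - x :: b) -> (0 < y) -> y \in partial_sums g.
  rewrite mem_partial_sums_cons => yP y0; have := sub_bg (x + y).
  rewrite !mem_partial_sums_cons => /(_ _)/orP[|/eqP|].
  - case/orP: yP => [/eqP|/andP[zy yb]]; first by lia.
    by rewrite orbC (_ : x + y - z = y - (z - x)) ?yb; lia.
  - by lia.
  by rewrite addKn => /andP[].
case: (eqVneq x z) => [exz|nxz].
  have [||||ss [ss_ok eb eg]] := IHg b => //; first by lia.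
    move=> y yb; have y0 : 0 < y.
      by rewrite lt0n; apply: contraNneq (partial_sums_gt0 b0) => <-.
    by apply: sub' => //; rewrite exz subnn mem_partial_sums_cons /= subn0 yb orbT.
  (* If no block follows, x is the last part and has to open a block. *)
  case: ss ss_ok eb eg => [|s ss] ss_ok eb eg.
    by exists [:: [:: x]]; split; rewrite /= ?eb ?eg ?exz ?addn0 ?mem_seq1 // eq_sym z0.
  move: ss_ok => /andP[/andP[s_n0 s0] ss_ok].
  exists ((x :: s) :: ss); split.
  - by rewrite /= in_cons negb_or eq_sym x0 s0.
  - by rewrite rhd_prod_cons rhd_cons // eb exz.
  by rewrite /= eg.
have [||||ss [ss_ok eb eg]] := IHg (z - x :: b) => //.
- by rewrite inE negb_or b0; lia.
- by rewrite /=; lia.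
- move=> y yb; apply: sub' => //; rewrite lt0n; apply: contraTneq yb => ->.
  by apply: partial_sums_gt0; rewrite inE negb_or b0; lia.
exists ([:: x] :: ss); split.
- by rewrite /= mem_seq1 eq_sym x0.
- by rewrite rhd_prod_cons -eb /= subnKC.
by rewrite /= eg.
Qed.

(** * Inversion generating functions under descent constraints *)

Local Open Scope ring_scope.

(** Taken over words rather than permutations, so that it applies to the restriction of a
    permutation to a block of positions. *)
Definition word_inv n (f : 'I_n -> nat) : nat :=
  (\sum_(i < n) \sum_(j < n) ((i < j) && (f j < f i)))%N.

(* As in [perm_descents], the descent f (j - 1) > f j sits at position j. *)
Definition descents_between n (lo hi : pred nat) (f : 'I_n -> nat) : bool :=
  [forall i : 'I_n, forall j : 'I_n, (i.+1 == j) ==>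
    ((lo j ==> (f j < f i)%N) && ((f j < f i)%N ==> hi j))].

Definition word_weight n lo hi (f : 'I_n -> nat) : {poly int} :=
  'X^(word_inv f) *+ descents_between lo hi f.

(** Taking [lo] = [hi] gives ribbon numbers, and [pred0], [predT] give the q-factorial. Constraints
    on all of [nat] make the passage to a later block a composition with [addn m]. *)
Definition inv_gf n (lo hi : pred nat) : {poly int} :=
  \sum_(w : 'S_n) word_weight lo hi (val \o w).

Lemma descents_betweenP n (lo hi : pred nat) (f : 'I_n -> nat) :
  reflect (forall i j : 'I_n, i.+1 = j ->
             (lo j -> f j < f i)%N /\ ((f j < f i)%N -> hi j))
          (descents_between lo hi f).
Proof.
apply: (iffP forallP) => [H i j ij | H i].
  move/forallP/(_ j): (H i); rewrite ij eqxx /= => /andP[/implyP ? /implyP ?].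
  by split.
apply/forallP => j; apply/implyP => /eqP /H [h1 h2].
by apply/andP; split; apply/implyP.
Qed.

Lemma eq_descents_between n (lo hi lo' hi' : pred nat) (f : 'I_n -> nat) :
  (forall i, 0 < i < n -> lo i = lo' i)%N ->
  (forall i, 0 < i < n -> hi i = hi' i)%N ->
  descents_between lo hi f = descents_between lo' hi' f.
Proof.
move=> elo ehi; apply/descents_betweenP/descents_betweenP => H i j ij;
  have := H i j ij; rewrite elo ?ehi // -ij /= ij ltn_ord //.
Qed.

Lemma eq_inv_gf n (lo hi lo' hi' : pred nat) :
  (forall i, 0 < i < n -> lo i = lo' i)%N ->
  (forall i, 0 < i < n -> hi i = hi' i)%N ->
  inv_gf n lo hi = inv_gf n lo' hi'.
Proof.
move=> elo ehi; apply: eq_bigr => w _.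
by rewrite /word_weight (eq_descents_between _ elo ehi).
Qed.

Lemma word_weight_order n lo hi (f g : 'I_n -> nat) :
  (forall i j, (f i < f j) = (g i < g j))%N ->
  word_weight lo hi f = word_weight lo hi g.
Proof.
move=> fg; rewrite /word_weight; congr ('X^_ *+ nat_of_bool _).
  by apply: eq_bigr => i _; apply: eq_bigr => j _; rewrite fg.
by apply/eq_forallb => i; apply/eq_forallb => j; rewrite fg.
Qed.

(** * Standardization of words with distinct letters *)

Section Standardization.
Variables (n : nat) (f : 'I_n -> nat).
Hypothesis f_inj : injective f.

Lemma rank_subproof i : (#|[set j | f j < f i]| < n)%N.
Proof.
rewrite -[X in (_ < X)%N]card_ord -cardsT; apply: proper_card.
by rewrite properT; apply/eqP => /setP/(_ i); rewrite !inE ltnn.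
Qed.

Definition rank i : 'I_n := Ordinal (rank_subproof i).

Lemma rank_lt i j : (rank i < rank j)%N = (f i < f j)%N.
Proof.
have mono a b : (f a <= f b)%N -> (rank a <= rank b)%N.
  by move=> ab; apply/subset_leq_card/subsetP => k; rewrite !inE => /leq_trans->.
apply/idP/idP => [|ij]; first by apply: contraTT; rewrite -!leqNgt => /mono.
apply: proper_card; rewrite properEneq andbC; apply/andP; split.
  by apply/subsetP => k; rewrite !inE => /ltn_trans->.
by apply/eqP => /setP/(_ i); rewrite !inE ltnn ij.
Qed.

Lemma rank_inj : injective rank.
Proof.
move=> i j ij; apply: f_inj; apply/eqP.
by rewrite eqn_leq (leqNgt (f i)) (leqNgt (f j)) -!rank_lt ij ltnn.
Qed.

Definition standardization : 'S_n := perm rank_inj.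

(** The weight depends only on the relative order of the letters, so [f] may be replaced by its
    standardization, which is absorbed by reindexing the symmetric group. Hence the sum does not
    depend on [f]. *)
Lemma sum_word_weight lo hi :
  \sum_(s : 'S_n) word_weight lo hi (f \o s) = inv_gf n lo hi.
Proof.
rewrite [RHS](reindex_inj (mulIg standardization)) /=.
apply: eq_bigr => s _; apply: word_weight_order => i j /=.
by rewrite !permM !permE /= rank_lt.
Qed.

End Standardization.

(** * Splitting the positions into two blocks *)

Section TwoBlocks.
Variables m p : nat.

Section BlockPerm.
Variables (s : 'S_m) (t : 'S_p).

Definition block_fun (i : 'I_(m + p)) : 'I_(m + p) :=
  match split i with inl x => lshift p (s x) | inr y => rshift m (t y) end.

Lemma block_fun_lshift x : block_fun (lshift p x) = lshift p (s x).
Proof. by rewrite /block_fun (unsplitK (inl _ x)). Qed.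

Lemma block_fun_rshift y : block_fun (rshift m y) = rshift m (t y).
Proof. by rewrite /block_fun (unsplitK (inr _ y)). Qed.

Lemma block_fun_inj : injective block_fun.
Proof.
move=> i j; case: (split_ordP i) => x ->; case: (split_ordP j) => y ->;
  rewrite ?block_fun_lshift ?block_fun_rshift.
- by move/lshift_inj/perm_inj->.
- by move/eqP; rewrite eq_lrshift.
- by move/eqP; rewrite eq_rlshift.
- by move/rshift_inj/perm_inj->.
Qed.

Definition block_perm : 'S_(m + p) := perm block_fun_inj.

Lemma block_permL x : block_perm (lshift p x) = lshift p (s x).
Proof. by rewrite permE block_fun_lshift. Qed.

Lemma block_permR y : block_perm (rshift m y) = rshift m (t y).
Proof. by rewrite permE block_fun_rshift. Qed.

End BlockPerm.

Definition cross_inv (f : 'I_(m + p) -> nat) : nat :=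
  (\sum_(i < m) \sum_(j < p) (f (rshift m j) < f (lshift p i)))%N.

Lemma cross_inv_block_perm s t (f : 'I_(m + p) -> nat) :
  cross_inv (f \o block_perm s t) = cross_inv f.
Proof.
rewrite /cross_inv [RHS](reindex_inj (@perm_inj _ s)) /=.
apply: eq_bigr => i _; rewrite [RHS](reindex_inj (@perm_inj _ t)) /=.
by apply: eq_bigr => j _; rewrite block_permL block_permR.
Qed.

Lemma word_inv_split (f : 'I_(m + p) -> nat) :
  word_inv f = (cross_inv f + word_inv (f \o @lshift m p)
                + word_inv (f \o @rshift m p))%N.
Proof.
rewrite /word_inv big_split_ord /=; congr (_ + _)%N.
  rewrite -big_split /=; apply: eq_bigr => i _.
  rewrite big_split_ord /= addnC; congr (_ + _)%N; apply: eq_bigr => j _.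
  by rewrite ltn_addr.
apply: eq_bigr => i _; rewrite big_split_ord /= big1 ?add0n => [|j _].
  by apply: eq_bigr => j _; rewrite ltn_add2l.
by rewrite ltnNge ltnW // ltn_addr.
Qed.

Lemma descents_between_split (lo hi : pred nat) (f : 'I_(m + p) -> nat) :
  ~~ lo m -> hi m ->
  descents_between lo hi f =
    descents_between lo hi (f \o @lshift m p) &&
    descents_between (lo \o addn m) (hi \o addn m) (f \o @rshift m p).
Proof.
move=> lom him; apply/descents_betweenP/andP =>
  [H | [/descents_betweenP HL /descents_betweenP HR] i j].
  split; apply/descents_betweenP => i j ij; first exact: (H (lshift p i) (lshift p j)).
  by apply: (H (rshift m i) (rshift m j)); rewrite /= -ij addnS.
case: (split_ordP i) => x ->; case: (split_ordP j) => y -> /= ij.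
- exact: HL.
(* The only consecutive pair straddling the blocks has its descent at position m, where [lo] and
   [hi] impose nothing. *)
- have y0 : y = 0%N :> nat by have := ltn_ord x; lia.
  by rewrite y0 addn0 him (negbTE lom).
- by have := ltn_ord y; lia.
- by apply: HR; lia.
Qed.

Lemma word_weight_split (lo hi : pred nat) (f : 'I_(m + p) -> nat) :
  ~~ lo m -> hi m ->
  word_weight lo hi f = 'X^(cross_inv f) *
    (word_weight lo hi (f \o @lshift m p) *
     word_weight (lo \o addn m) (hi \o addn m) (f \o @rshift m p)).
Proof.
move=> lom him; rewrite /word_weight word_inv_split descents_between_split //.
case: descents_between; case: descents_between;
  by rewrite /= ?mulr0n ?mul0r ?mulr0 // !mulr1n !exprD mulrA.
Qed.

(* Cross inversions are invariant under permuting positions inside the blocks, so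
   averaging over such permutations makes the two patterns independent of each
   other and of the cross inversions. *)
Lemma inv_gf_split_average (lo hi : pred nat) :
  ~~ lo m -> hi m ->
  inv_gf (m + p) lo hi *+ (m`! * p`!) =
    (\sum_(w : 'S_(m + p)) 'X^(cross_inv (val \o w))) *
    (inv_gf m lo hi * inv_gf p (lo \o addn m) (hi \o addn m)).
Proof.
move=> lom him.
(* One copy of the generating function for each pair (s, t); in that copy w is replaced by its
   composite with the block permutation acting on positions. *)
transitivity (\sum_(s : 'S_m) \sum_(t : 'S_p) inv_gf (m + p) lo hi).
  by rewrite !sumr_const !cardT -!cardE !card_Sn -mulrnA mulnC.
transitivity (\sum_(s : 'S_m) \sum_(t : 'S_p) \sum_(w : 'S_(m + p))
   'X^(cross_inv (val \o w)) *
    (word_weight lo hi (val \o w \o @lshift m p \o s) *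
     word_weight (lo \o addn m) (hi \o addn m) (val \o w \o @rshift m p \o t))).
  apply: eq_bigr => s _; apply: eq_bigr => t _.
  rewrite /inv_gf (reindex_inj (mulgI (block_perm s t))) /=.
  apply: eq_bigr => w _; rewrite word_weight_split //.
  congr ('X^_ * (_ * _)); last 2 first.
  - by apply: word_weight_order => i j /=; rewrite !permM !block_permL.
  - by apply: word_weight_order => i j /=; rewrite !permM !block_permR.
  rewrite -[RHS](cross_inv_block_perm s t); apply: eq_bigr => i _.
  by apply: eq_bigr => j _; rewrite /= !permM.
under eq_bigr do rewrite exchange_big.
(* For fixed w the sums over s and t separate, and standardizing the two halves of w makes both
   independent of w. *)
rewrite exchange_big mulr_suml; apply: eq_bigr => w _ /=.
under eq_bigr do rewrite -mulr_sumr -mulr_sumr.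
rewrite -mulr_sumr -mulr_suml; congr (_ * (_ * _)); apply: sum_word_weight.
  by move=> i j /val_inj /perm_inj /lshift_inj.
by move=> i j /val_inj /perm_inj /rshift_inj.
Qed.

End TwoBlocks.

(** * Evaluation by q-factorials *)

Lemma inv_gf_small n lo hi : (n <= 1)%N -> inv_gf n lo hi = 1.
Proof.
move=> n1; rewrite /inv_gf (eq_bigr (fun=> 1)) => [|w _].
  rewrite sumr_const cardT -cardE card_Sn.
  by case: n n1 => [|[]].
have H (i j : 'I_n) : i = j :> nat by have := ltn_ord i; have := ltn_ord j; lia.
rewrite /word_weight /word_inv big1 => [|i _]; last first.
  by rewrite big1 // => j _; rewrite (H i j) ltnn.
suff -> : descents_between lo hi (val \o w) by [].
by apply/descents_betweenP => i j ij; have := H i j; lia.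
Qed.

Lemma poly_mulrn_inj (k : nat) (a b : {poly int}) :
  (0 < k)%N -> a *+ k = b *+ k -> a = b.
Proof.
move=> k0 /polyP ab; apply/polyP => i; have := ab i.
by rewrite !coefMn => /eqP; rewrite Num.Theory.eqr_pMn2r // => /eqP.
Qed.

(** The values smaller than the first entry all stand to its right, and their number is that entry,
    values being counted from 0. *)
Lemma cross_inv1 n (w : 'S_(1 + n)) : cross_inv (val \o w) = w ord0.
Proof.
rewrite /cross_inv big_ord1.
have -> : lshift n ord0 = ord0 :> 'I_(1 + n) by apply: val_inj.
rewrite -[RHS]card_ord -sum1_card (big_ord_widen _ (fun=> 1%N) (ltnW (ltn_ord (w ord0)))).
rewrite [RHS]big_mkcond [RHS](reindex_inj (@perm_inj _ w)) [RHS]big_ord_recl /=.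
rewrite ltnn add0n; apply: eq_bigr => i _.
have -> : rshift 1 i = lift ord0 i :> 'I_(1 + n) by apply: val_inj.
by case: ltnP.
Qed.

(** Induction with a first block of size 1: the cross inversions record the first entry, which is
    uniformly distributed and contributes [n+1]_q. *)
Lemma inv_gf_q_fact n : inv_gf n pred0 predT = q_fact n.
Proof.
elim: n => [|n IHn]; first by rewrite inv_gf_small // /q_fact big_geq.
have cross : (\sum_(w : 'S_(1 + n)) 'X^(cross_inv (val \o w))) *+ n.+1 = q_int n.+1 *+ n.+1`!.
  (* Uniformity by averaging over the cyclic shifts of the values modulo n + 1: for fixed w, the
     shifted first entry takes every value once. *)
  transitivity (\sum_(k : 'I_n.+1) \sum_(w : 'S_(1 + n)) 'X^((w ord0 + k)%R : 'I_n.+1) : {poly int}).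
    rewrite -[X in _ *+ X]card_ord -sumr_const; apply: eq_bigr => k _.
    rewrite [LHS](reindex_inj (mulIg (perm (addIr k)))); apply: eq_bigr => w _.
    by rewrite cross_inv1 permM permE.
  rewrite exchange_big /=.
  transitivity (\sum_(w : 'S_(1 + n)) q_int n.+1); last first.
    by rewrite sumr_const cardT -cardE card_Sn.
  by apply: eq_bigr => w _; rewrite /q_int [RHS](reindex_inj (addrI (w ord0))).
apply: (@poly_mulrn_inj n.+1`!); first exact: fact_gt0.
have := @inv_gf_split_average 1 n pred0 predT isT isT.
rewrite (@inv_gf_small 1) // mul1r mul1n (_ : inv_gf n _ _ = q_fact n) // => E.
rewrite factS mulnC mulrnA E -mulrnAl cross /q_fact [in RHS]big_nat_recr //=.
by rewrite mulrnAl mulrC mulnC -factS.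
Qed.

(** The averaging identity is used twice, with the given constraints and with none. Both contain the
    same sum over cross inversions, so multiplying each by the other's block factors gives equal
    products. *)
Lemma inv_gf_split m p (lo hi : pred nat) :
  ~~ lo m -> hi m ->
  inv_gf (m + p) lo hi * (q_fact m * q_fact p) =
  q_fact (m + p) * (inv_gf m lo hi * inv_gf p (lo \o addn m) (hi \o addn m)).
Proof.
move=> lom him; apply: (@poly_mulrn_inj (m`! * p`!)).
  by rewrite muln_gt0 !fact_gt0.
rewrite -!mulrnAl inv_gf_split_average // -!inv_gf_q_fact inv_gf_split_average //.
by rewrite mulrAC.
Qed.

(** * Ribbon numbers as constrained generating functions *)

Lemma sumn_parts n (c : composition n) : sumn c = n.
Proof. by have /andP[_ /eqP] := valP c. Qed.

Lemma parts_gt0 n (c : composition n) : 0%N \notin parts c.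
Proof. by have /andP[] := valP c. Qed.

Lemma mem_perm_descents n (w : 'S_n) (i j : 'I_n) :
  i.+1 = j -> (j \in perm_descents w) = (w j < w i)%N.
Proof.
move=> ij; rewrite inE; apply/existsP/idP => [[k /andP[/eqP kj]]|wji].
  by have -> : i = k by apply: val_inj; apply: succn_inj; rewrite ij kj.
by exists i; rewrite ij eqxx.
Qed.

Lemma perm_descents_gt0 n (w : 'S_n) i : i \in perm_descents w -> (0 < i)%N.
Proof. by rewrite inE => /existsP[k /andP[/eqP<-]]. Qed.

Lemma descents_gt0 n (c : composition n) i : i \in descents c -> (0 < i)%N.
Proof.
rewrite mem_descents lt0n; apply: contraTneq => ->.
exact: partial_sums_gt0 (parts_gt0 c).
Qed.

Lemma descents_between_perm n (b g : composition n) (w : 'S_n) :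
  descents_between [in partial_sums b] [in partial_sums g] (val \o w) =
    (descents b \subset perm_descents w) && (perm_descents w \subset descents g).
Proof.
apply/descents_betweenP/andP => [H|[/subsetP bw /subsetP wg] i j ij].
  split; apply/subsetP => j jD.
    have j0 := descents_gt0 jD; have ij : (j.-1 < n)%N by have := ltn_ord j; lia.
    have e : (Ordinal ij).+1 = j by rewrite /= prednK.
    rewrite (mem_perm_descents _ e); apply: (H _ _ e).1.
    by rewrite -mem_descents.
  have j0 := perm_descents_gt0 jD; have ij : (j.-1 < n)%N by have := ltn_ord j; lia.
  have e : (Ordinal ij).+1 = j by rewrite /= prednK.
  by rewrite mem_descents; apply: (H _ _ e).2; rewrite /= -(mem_perm_descents _ e).
split=> [|wji]; first by rewrite -mem_descents => /bw; rewrite (mem_perm_descents _ ij).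
by rewrite -mem_descents; apply: wg; rewrite (mem_perm_descents _ ij).
Qed.

Lemma inv_word_inv n (w : 'S_n) : Defs.inv w = word_inv (val \o w).
Proof.
rewrite /Defs.inv -sum1dep_card big_mkcond /word_inv pair_big /=.
by apply: eq_bigr => p _; case: ifP.
Qed.

(** Equal lower and upper bounds force the descent set. The size is written [sumn c] so that the
    right side depends on the underlying sequence only, as products over lists of blocks require. *)
Lemma q_ribbon_inv_gf n (c : composition n) :
  q_ribbon c = inv_gf (sumn c) [in partial_sums c] [in partial_sums c].
Proof.
rewrite sumn_parts /q_ribbon big_mkcond; apply: eq_bigr => w _.
rewrite /word_weight descents_between_perm andbC -eqEsubset inv_word_inv.
by case: eqP.
Qed.

Lemma sum_q_ribbon n (b g : composition n) :
  \sum_(c : composition n | refines b c && refines c g) q_ribbon c =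
  inv_gf n [in partial_sums b] [in partial_sums g].
Proof.
rewrite /q_ribbon (exchange_big_dep xpredT) //=; apply: eq_bigr => w _.
rewrite /word_weight descents_between_perm -inv_word_inv.
(* Each w contributes to exactly one ribbon number, that of the composition whose descent set is
   D(w). *)
have [c cw] := descents_surj (@perm_descents_gt0 _ w).
rewrite (eq_bigl (fun d => (d == c) && (refines b c && refines c g))) => [|d].
  rewrite big_mkcondr big_pred1_eq /refines cw.
  by case: ifP.
rewrite -cw eq_sym andbC (inj_eq (@descents_inj n)).
by case: eqP => // ->.
Qed.

Lemma q_fact_neq0 n : q_fact n != 0.
Proof.
rewrite prodf_seq_neq0; apply/allP => i; rewrite mem_index_iota => /andP[i0 _] /=.
(* At q = 1 the factor [i]_q takes the value i > 0. *)
apply/eqP => /(congr1 (horner^~ 1)) /eqP; rewrite horner0 horner_sum.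
under eq_bigr do rewrite hornerXn expr1n.
by rewrite sumr_const card_ord Num.Theory.pnatr_eq0 eqn0Ngt i0.
Qed.

(** * Induction on the number of blocks *)

Lemma inv_gf_blocks ss : good_blocks ss ->
  inv_gf (sumn (flatten ss)) [in partial_sums (rhd_prod ss)]
                             [in partial_sums (flatten ss)] *
    \prod_(s <- ss) q_fact (sumn s) =
  q_fact (sumn (flatten ss)) *
    \prod_(s <- ss) inv_gf (sumn s) [in partial_sums s] [in partial_sums s].
Proof.
elim: ss => [|s ss IHs]; first by rewrite !big_nil inv_gf_small // /q_fact big_geq.
(* A single block is treated apart: its end [sumn s] is not a junction, and it satisfies the lower
   constraint, so the two-block splitting does not apply. *)
case: (eqVneq ss [::]) => [-> _|ss_n0].
  by rewrite !big_seq1 rhd_prod_cons rhds0 /= cats0 mulrC.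
move=> /andP[/andP[s_n0 s0] ss_ok]; have /andP[p_n0 p0] := good_rhd_prod ss_ok ss_n0.
have := IHs ss_ok; set lo := [in _]; set hi := [in _]; set lo' := [in _]; set hi' := [in _].
rewrite /= sumn_cat !big_cons.
have memlo' i : lo' i = if (i < sumn s)%N then i \in partial_sums s else lo (i - sumn s)%N.
  exact: mem_partial_sums_rhd.
have memhi' i : hi' i = (i \in partial_sums s) || ((sumn s <= i) && hi (i - sumn s))%N.
  by rewrite /hi' /= partial_sums_cat mem_cat mem_map_addn.
have ps_gt i : (sumn s < i)%N -> (i \in partial_sums s) = false.
  by move=> si; apply: contraTF si => /partial_sums_le; rewrite -leqNgt.
have lo_m : ~~ lo' (sumn s) by rewrite memlo' ltnn subnn partial_sums_gt0.
have hi_m : hi' (sumn s) by rewrite memhi' sumn_partial_sums.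
have := inv_gf_split (sumn (flatten ss)) lo_m hi_m.
have -> : inv_gf (sumn s) lo' hi' =
          inv_gf (sumn s) [in partial_sums s] [in partial_sums s].
  apply: eq_inv_gf => i /andP[_ i_s]; first by rewrite memlo' i_s.
  by rewrite memhi' leqNgt i_s orbF.
have -> : inv_gf (sumn (flatten ss)) (lo' \o addn (sumn s)) (hi' \o addn (sumn s)) =
          inv_gf (sumn (flatten ss)) lo hi.
  apply: eq_inv_gf => i /andP[i0 _] /=; first by rewrite memlo' ltnNge leq_addr addKn.
  by rewrite memhi' ps_gt ?leq_addr ?addKn // -[X in (X < _)%N]addn0 ltn_add2l.
(* The q-factorial of the total size of the remaining blocks links the two identities: it is a
   factor on the left of [E] and on the right of [IH]. *)
move=> E IH; apply: (mulIf (q_fact_neq0 (sumn (flatten ss)))).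
rewrite -mulrA [_ * _ * q_fact _]mulrAC mulrA E -!mulrA; congr (_ * (_ * _)).
by rewrite IH mulrC.
Qed.

(** * Families of compositions and the final identity *)

Section Family.
Variables (n : nat) (nu : composition n) (a : comp_family nu).

Lemma map_sumn_family_seq : map sumn (family_seq a) = nu.
Proof.
rewrite /family_seq -map_comp -[RHS](mkseq_nth 0%N) /mkseq -val_enum_ord -map_comp.
by apply: eq_map => i /=; rewrite sumn_parts.
Qed.

Lemma good_family_seq : good_blocks (family_seq a).
Proof.
apply/allP => _ /mapP[i _ ->]; rewrite parts_gt0 andbT.
apply: contraNneq (parts_gt0 nu) => ai0.
by have := sumn_parts (a i); rewrite ai0 => /= ->; rewrite mem_nth.
Qed.

Lemma prod_family_seq :
  \prod_(i < size nu) q_ribbon (a i) =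
  \prod_(s <- family_seq a) inv_gf (sumn s) [in partial_sums s] [in partial_sums s].
Proof.
by rewrite big_map big_enum; apply: eq_bigr => i _; exact: q_ribbon_inv_gf.
Qed.

End Family.

Lemma exists_decomposition n (beta gamma : composition n) :
  refines beta gamma ->
  exists (nu : composition n) (a : comp_family nu), is_decomposition beta gamma a.
Proof.
move=> /subsetP bg.
have sub_bg : {subset partial_sums beta <= partial_sums gamma}.
  (* Refinement only compares positions below n. The remaining value n is the total of [gamma],
     unless [gamma] is empty; then n = 0, which is not a partial sum of [beta]. *)
  move=> i ib; have := partial_sums_le ib; rewrite sumn_parts leq_eqVlt.
  case/orP => [/eqP i_n|i_n]; last first.
    by have := bg (Ordinal i_n); rewrite !mem_descents; apply.
  have -> : i = sumn gamma by rewrite sumn_parts.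
  apply: sumn_partial_sums.
  apply: contraTneq ib => g_nil.
  have -> : i = 0%N by rewrite i_n -(sumn_parts gamma) g_nil.
  exact: partial_sums_gt0 (parts_gt0 beta).
have [] := exists_blocks (parts_gt0 beta) (parts_gt0 gamma) _ sub_bg.
  by rewrite !sumn_parts.
move=> ss [ss_ok eb eg].
have nu_ok : (0%N \notin map sumn ss) && (sumn (map sumn ss) == n).
  rewrite -sumn_flatten -eg sumn_parts eqxx andbT.
  apply/mapP => -[s /(allP ss_ok) /andP[s_n0 s0] e].
  by have := sumn_gt0 s_n0 s0; rewrite -e.
pose nu := Composition nu_ok.
have a_ok (i : 'I_(size nu)) :
  (0%N \notin nth [::] ss i) && (sumn (nth [::] ss i) == nth 0%N nu i).
  have iss : (i < size ss)%N by rewrite -(size_map sumn ss); exact: ltn_ord.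
  rewrite (nth_map [::]) // eqxx andbT.
  by have /andP[] := allP ss_ok _ (mem_nth [::] iss).
pose a : comp_family nu := fun i => Composition (a_ok i).
have aE : family_seq a = ss.
  rewrite -[RHS](mkseq_nth [::]) /mkseq -(size_map sumn ss) -[size _]/(size nu).
  by rewrite -val_enum_ord -map_comp; apply: eq_map.
exists nu, a; split; rewrite ?aE //.
apply/setP => i; rewrite in_setD !mem_descents /= andbC.
case: (posnP i) => [i0|i0].
  by rewrite i0 !(negbTE (partial_sums_gt0 _)) ?parts_gt0 //; have /andP[] := nu_ok.
rewrite mem_partial_sums_sumn_blocks ?eg ?eb // i0 -eg sumn_parts.
exact: ltn_ord.
Qed.

Theorem corollary5p10 (n : nat) (beta gamma : composition n) :
  refines beta gamma ->
  (exists (nu : composition n) (a : comp_family nu), is_decomposition beta gamma a) /\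
  (forall (nu : composition n) (a : comp_family nu), is_decomposition beta gamma a ->
     (\sum_(alpha : composition n | refines beta alpha && refines alpha gamma)
        q_ribbon alpha)%:F =
     q_multinomial n nu * (\prod_(i < size nu) q_ribbon (a i))%:F).
Proof.
move=> bg; split=> [|nu a [_ eb eg]]; first exact: exists_decomposition.
rewrite sum_q_ribbon prod_family_seq /q_multinomial -{1}(map_sumn_family_seq a).
have := inv_gf_blocks (good_family_seq a); rewrite -eb -eg sumn_parts => E.
(* The identity [E] over Z[q] is carried to the fraction field, where the nonzero product of
   q-factorials cancels. *)
rewrite big_map -rmorph_prod mulrAC -rmorphM -E rmorphM /= mulfK //.
rewrite tofrac_eq0 prodf_seq_neq0; apply/allP => s _; exact: q_fact_neq0.
Qed.
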